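(* There exists a universal constant $c>0$ such that the following holds. Let $f:\mathbb{R}^d\to\mathbb{R}$ be differentiable (not necessarily convex) with a global minimizer $x^*$, and let $g(x,\xi)$ be a stochastic gradient of $f$. Suppose that: (i) $f$ is $L$-smooth ($L>0$): $\|\nabla f(x)-\nabla f(y)\|_2\le L\|x-y\|_2$ for all $x,y\in\mathbb{R}^d$; (ii) $\mathbb{E}_\xi[g(x,\xi)]=\nabla f(x)$ for all $x\in\mathbb{R}^d$; (iii) for some constant $\sigma^2>0$, $\mathbb{E}_\xi\left[\exp\left(\|g(x,\xi)-\nabla f(x)\|_2^2/\sigma^2\right)\right]\le\exp(1)$ for all $x\in\mathbb{R}^d$. Let $\delta\in(0,1)$. Run Batched SGD on $T=KH$ samples with $K=\sqrt{T}$ batches and step-size $\alpha=1/(2L)$, and set $r^{(0)}:=f(x^{(0)})-f(x^* )$. Then, with probability at least $1-\delta$, $$\frac1K\sum_{k=0}^{K-1}\|\nabla f(x^{(k)})\|_2^2\le\frac{8Lr^{(0)}}{\sqrt T}+\frac{8c^2\sigma^2}{\sqrt T}\log\frac{2dT}{\delta}.$$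
   Context: Batched SGD: let $\xi_0,\xi_1,\dots,\xi_{T-1}$ be i.i.d. random variables distributed as $\xi$. The $T$ samples are split into $K$ batches of $H$ samples each, with $T=KH$ and $K,H$ positive integers (the prescribed value of $K$ is assumed to be a positive integer dividing $T$). Starting from a deterministic initial parameter $x^{(0)}\in\mathbb{R}^d$, for $k=0,\dots,K-1$, $$g_k:=\frac1H\sum_{\ell=0}^{H-1}g(x^{(k)},\xi_{kH+\ell}),\qquad x^{(k+1)}=x^{(k)}-\alpha g_k .$$ $\log$ is the natural logarithm. ''Universal constant'' means an absolute constant, independent of $f$, $g$, $d$, $L$, $\sigma$, $T$, $K$, $H$, $\delta$, $x^{(0)}$. *)

(* Defs.v *)
From HB Require Import structures.
From mathcomp Require Import all_boot all_order all_algebra.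
From mathcomp Require Import all_classical all_reals all_analysis.
Set Implicit Arguments.
Unset Strict Implicit.
Unset Printing Implicit Defensive.
Import Order.TTheory GRing.Theory Num.Theory.
Import numFieldNormedType.Exports.
Local Open Scope classical_set_scope.
Local Open Scope ring_scope.

(* The library's norm on ['rV[R]_d] is the sup norm, hence this definition. *)
Definition l2norm (R : realType) (d : nat) (x : 'rV[R]_d) : R :=
  Num.sqrt (\sum_(i < d) x 0 i ^+ 2).

Definition grad (R : realType) (d : nat) (f : 'rV[R]_d -> R) (x : 'rV[R]_d) :
    'rV[R]_d :=
  \row_(i < d) 'D_(delta_mx 0 i) f x.

Definition borel_rV (R : realType) (d : nat) :=
  g_sigma_algebraType (@open 'rV[R]_d).

Definition mutually_independent (dO dX : measure_display)
    (Omega : measurableType dO) (Xi : measurableType dX) (R : realType)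
    (P : probability Omega R) (n : nat) (X : 'I_n -> {RV P >-> Xi}) : Prop :=
  forall (J : {set 'I_n}) (A : 'I_n -> set Xi),
    (forall i, measurable (A i)) ->
    P (\bigcap_(i in [set` J]) (X i @^-1` A i)) =
    (\prod_(i in J) P (X i @^-1` A i))%E.

(* Only [xi 0, ..., xi n.-1] are constrained. The laws are compared on
   measurable sets only, as the value of a measure on other sets is
   meaningless. *)
Definition iid_samples (dO dX : measure_display)
    (Omega : measurableType dO) (Xi : measurableType dX) (R : realType)
    (P : probability Omega R) (mu : probability Xi R) (n : nat)
    (xi : nat -> {RV P >-> Xi}) : Prop :=
  (forall t : nat, (t < n)%N -> forall A : set Xi, measurable A ->
     distribution P (xi t) A = mu A) /\
  mutually_independent (fun t : 'I_n => xi t).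

Definition batch_gradient (R : realType) (d : nat) (Xi : Type)
    (g : 'rV[R]_d -> Xi -> 'rV[R]_d) (H : nat) (s : nat -> Xi) (k : nat)
    (x : 'rV[R]_d) : 'rV[R]_d :=
  H%:R^-1 *: \sum_(l < H) g x (s (k * H + l)%N).

Fixpoint batched_sgd (R : realType) (d : nat) (Xi : Type)
    (g : 'rV[R]_d -> Xi -> 'rV[R]_d) (H : nat) (alpha : R) (x0 : 'rV[R]_d)
    (s : nat -> Xi) (k : nat) : 'rV[R]_d :=
  if k is k'.+1 then
    let x := batched_sgd g H alpha x0 s k' in
    x - alpha *: batch_gradient g H s k' x
  else x0.

(* Main.v *)
Require Import Defs.
From HB Require Import structures.
From mathcomp Require Import all_boot all_order all_algebra.
From mathcomp Require Import all_classical all_reals all_analysis.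
From mathcomp Require Import measurable_realfun ring lra.
Import Order.TTheory GRing.Theory Num.Theory.
Import numFieldNormedType.Exports.
Local Open Scope classical_set_scope.
Local Open Scope ring_scope.

(** Write [G_k] for the gradient at the k-th iterate and [e_k] for the error of
    the k-th batch gradient.

    Optimization.  Smoothness gives the quadratic upper bound
    [smooth_quadratic_bound]; with step-size 1/(2L) one inexact gradient step
    then decreases f by at least (|G_k|^2 - |e_k|^2) / (4L)
    ([inexact_gradient_step]).  Telescoping yields
      sum_k |G_k|^2 <= 4 L r0 + sum_k |e_k|^2   ([sum_sqr_grad_batched_sgd]),
    for every sample path, so only the sum of the |e_k|^2 has to be controlled.

    Concentration.  [H e_k / sigma] is a sum of H independent noise vectors,
    centered and sub-Gaussian in norm given the iterate.  The exponential moment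
    of the squared norm of such a sum is bounded without any dependence on the
    dimension, by following exp (a_l |S_l|^2) along the partial sums S_l with
    slowly decreasing a_l = 1 / (16 (H + l)).  One more noise vector turns a into
    a (1 + 16 a) at the cost of a factor exp a ([integral_expR_sqr_step]), and
    this increase is absorbed by a_l - a_(l+1), while the factors multiply up to
    at most exp (1/16) ([integral_expR_partial_sum]).  Hence, with
    Y_k = |S_H|^2 / (32 H) computed in the k-th batch, E exp Y_k <= exp (1/16).

    The batches need not be combined by conditioning: exp is convex, so the mean
    of the Y_k has the same exponential moment, and a Chernoff bound
    ([chernoff_mean]) gives mean Y_k < log (2dT/delta) outside an event of
    probability at most exp (1/16) delta / (2dT) <= delta.  As H = K = sqrt T, the
    sum of the |e_k|^2 equals 32 sigma^2 times that mean, hence c = 2.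

    Measure theory.  A function of the first t samples is independent of sample
    t: by a pi-lambda argument this only has to be checked on cylinders
    ([past_indep]).  The expectation of a function of both is therefore an
    iterated integral ([integral_freezing]), which is how the one-step estimate,
    valid for a fixed vector, gets applied to the random partial sums.  The
    iterates and partial sums are functions of the past because measurability
    for the Borel sets of a row space can be tested on coordinates
    ([measurable_fun_borel_rV]). *)

(** * Euclidean geometry of row vectors *)

Definition dot {R : realType} {d : nat} (u v : 'rV[R]_d) : R :=
  \sum_(i < d) u 0 i * v 0 i.

Section dot_theory.
Context {R : realType} {d : nat}.
Implicit Types u v w : 'rV[R]_d.

Lemma dotC u v : dot u v = dot v u.
Proof. by apply: eq_bigr => i _; rewrite mulrC. Qed.

Lemma dotDr u v w : dot u (v + w) = dot u v + dot u w.
Proof. by rewrite -big_split; apply: eq_bigr => i _; rewrite mxE mulrDr. Qed.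

Lemma dotZr (a : R) u v : dot u (a *: v) = a * dot u v.
Proof. by rewrite mulr_sumr; apply: eq_bigr => i _; rewrite mxE mulrCA. Qed.

Lemma dotDl u v w : dot (v + w) u = dot v u + dot w u.
Proof. by rewrite dotC dotDr !(dotC u). Qed.

Lemma dotZl (a : R) u v : dot (a *: v) u = a * dot v u.
Proof. by rewrite dotC dotZr dotC. Qed.

Lemma dotBr u v w : dot u (v - w) = dot u v - dot u w.
Proof. by rewrite dotDr -scaleN1r dotZr mulN1r. Qed.

Lemma dotBl u v w : dot (v - w) u = dot v u - dot w u.
Proof. by rewrite dotC dotBr !(dotC u). Qed.

Lemma dot0r u : dot u 0 = 0.
Proof. by rewrite -[0](scale0r 0) dotZr mul0r. Qed.

Lemma dotvv_ge0 u : 0 <= dot u u.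
Proof. by apply: sumr_ge0 => i _; rewrite -expr2 sqr_ge0. Qed.

Lemma sqr_l2norm u : l2norm u ^+ 2 = dot u u.
Proof.
rewrite /l2norm; under eq_bigr do rewrite expr2.
by rewrite sqr_sqrtr// dotvv_ge0.
Qed.

Lemma l2norm_ge0 u : 0 <= l2norm u.
Proof. exact: sqrtr_ge0. Qed.

Lemma l2normZ (a : R) u : 0 <= a -> l2norm (a *: u) = a * l2norm u.
Proof.
move=> a0; apply/eqP; rewrite -(@eqrXn2 _ 2)//.
- by rewrite exprMn !sqr_l2norm dotZl dotZr expr2 mulrA.
- exact: l2norm_ge0.
- by rewrite mulr_ge0// l2norm_ge0.
Qed.

Lemma CauchySchwarz_dot u v : dot u v ^+ 2 <= dot u u * dot v v.
Proof.
have [v0|v0] := eqVneq (dot v v) 0.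
  suff -> : v = 0 by rewrite !dot0r mulr0 expr0n.
  apply/rowP => i; rewrite mxE; apply/eqP; rewrite -[_ == 0](@sqrf_eq0 R).
  move/eqP: v0; rewrite psumr_eq0; last by move=> j _; rewrite -expr2 sqr_ge0.
  by move/allP => /(_ i (mem_index_enum _)); rewrite -expr2.
have vp : 0 < dot v v by rewrite lt_def v0 dotvv_ge0.
(* |v|^2 times the component of u orthogonal to v *)
have := dotvv_ge0 (dot v v *: u - dot u v *: v).
have -> : dot (dot v v *: u - dot u v *: v) (dot v v *: u - dot u v *: v) =
    dot v v * (dot u u * dot v v - dot u v ^+ 2).
  by rewrite dotBl !dotBr !dotZl !dotZr (dotC v u); ring.
by rewrite pmulr_rge0// subr_ge0.
Qed.

Lemma dot_le_l2norm u v : dot u v <= l2norm u * l2norm v.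
Proof.
apply: le_trans (ler_norm _) _.
rewrite -[leLHS]sqrtr_sqr -[l2norm u * _]ger0_norm ?mulr_ge0 ?l2norm_ge0//.
rewrite -(sqrtr_sqr (l2norm u * _)) ler_sqrt ?sqr_ge0//.
by rewrite exprMn !sqr_l2norm CauchySchwarz_dot.
Qed.

Lemma le_l2norm_dot (r : R) u v : 0 <= r ->
  (l2norm u <= r) = (dot u u <= r ^+ 2).
Proof. by move=> r0; rewrite -sqr_l2norm ler_sqr ?nnegrE ?l2norm_ge0. Qed.

End dot_theory.

(** * Scalar inequalities for the exponential *)

Section scalar.
Context {R : realType}.
Implicit Types t p u : R.

(** For a centered variable the linear term integrates to 0, so this reduces its
    exponential moments to exponential moments of its square.  The inequality
    also holds with 1 instead of 2, but 2 leaves room to prove it from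
    1 + t <= exp t alone. *)
Lemma expR_le_linear_sqr t : expR t <= t + expR (2 * t ^+ 2).
Proof.
(* exp s <= 1 / (1 - s), in a form that avoids the division *)
have inv (s q : R) : s < 1 -> 1 <= q * (1 - s) -> expR s <= q.
  move=> s1 hq.
  have e1 : expR s * (1 - s) <= 1.
    rewrite -[leRHS](expRxMexpNx_1 s) ler_wpM2l ?expR_ge0//.
    by have := expR_ge1Dx (- s).
  by rewrite -(@ler_pM2r _ (1 - s)) ?subr_gt0// (le_trans e1).
have e2 := expR_ge1Dx (2 * t ^+ 2).
have [t0|t0] := lerP t 0.
  suff : expR t <= 1 + t + t ^+ 2 by nra.
  apply: inv; first lra.
  have -> : (1 + t + t ^+ 2) * (1 - t) = 1 - t * t ^+ 2 by ring.
  have := sqr_ge0 t; nra.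
have [t1|t1] := lerP t (1/2).
  suff : expR t <= 1 + t + 2 * t ^+ 2 by nra.
  apply: inv; first lra.
  have -> : (1 + t + 2 * t ^+ 2) * (1 - t) = 1 + t ^+ 2 * (1 - 2 * t) by ring.
  have := sqr_ge0 t; nra.
have : expR t <= expR (2 * t ^+ 2) by rewrite ler_expR; nra.
by lra.
Qed.

(** Convexity of exp between 0 and [u - 1].  Anchoring the chord at exponent 1
    serves an integrated form of Jensen's inequality: if E exp U <= exp 1, then
    the right-hand side has expectation at most 1, that is,
    E exp (p U) <= exp p. *)
Lemma expR_chord p u : 0 <= p <= 1 ->
  expR (p * (u - 1)) <= 1 - p + p * expR (u - 1).
Proof.
move=> /andP[p0 p1]; set v := u - 1.
have h1 := expR_ge1Dx (v - p * v); have h2 := expR_ge1Dx (- (p * v)).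
have -> : expR v = expR (p * v) * expR (v - p * v).
  by rewrite -expRD; congr expR; ring.
have e0 := expR_gt0 (p * v).
have k1 : expR (p * v) * (1 - p * v) <= 1.
  by rewrite -[leRHS](expRxMexpNx_1 (p * v)) ler_pM2l.
have : p * (expR (p * v) * (1 + (v - p * v))) <=
    p * (expR (p * v) * expR (v - p * v)) by rewrite ler_wpM2l// ler_pM2l.
have : (1 - p) * (expR (p * v) * (1 - p * v)) <= 1 - p.
  by rewrite -[leRHS]mulr1 ler_wpM2l// subr_ge0.
set X := expR (p * v); set Y := expR _ => h3 h4.
have E : X = (1 - p) * (X * (1 - p * v)) + p * (X * (1 + (v - p * v))) by ring.
by rewrite [leLHS]E lerD.
Qed.


End scalar.

(** * One noise vector: pointwise bounds with computable expectation *)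

Section one_step.
Context {R : realType} {d : nat}.
Implicit Types x v z : 'rV[R]_d.

(** A sub-Gaussian bound E exp (v . z) <= exp (2 |v|^2) in a pointwise form:
    integrating over a centered z with E exp |z|^2 <= exp 1 makes the right-hand
    side at most 1.  For small v the linear term is needed; for large v,
    v . z <= |v|^2 + |z|^2 / 4 is enough. *)
Lemma expR_dot_bound v : exists kappa rho : R, 0 <= rho <= 1 /\
  forall z, expR (dot v z - 2 * dot v v) <=
    kappa * dot v z + (1 - rho + rho * expR (dot z z - 1)).
Proof.
have v0 := dotvv_ge0 v.
have [v1|v1] := lerP (2 * dot v v) 1.
  exists (expR (- (2 * dot v v))), (2 * dot v v); split=> [|z].
    by rewrite v1 mulr_ge0.
  have h1 := expR_le_linear_sqr (dot v z).
  have h2 : expR (2 * dot v z ^+ 2) <= expR (2 * dot v v * dot z z).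
    by rewrite ler_expR; have := CauchySchwarz_dot v z; lra.
  have h3 := @expR_chord _ (2 * dot v v) (dot z z) _.
  rewrite [dot v z - _]addrC [leLHS]expRD.
  apply: (@le_trans _ _ (expR (- (2 * dot v v)) * dot v z +
    expR (- (2 * dot v v)) * expR (2 * dot v v * dot z z))).
    by rewrite -mulrDr ler_pM2l ?expR_gt0// (le_trans h1)// lerD2l.
  rewrite lerD2l -expRD (_ : _ + _ = 2 * dot v v * (dot z z - 1)); last by ring.
  by apply: h3; rewrite v1 mulr_ge0.
exists 0, (1/4); split=> [|z]; first lra.
rewrite mul0r add0r; apply: le_trans (@expR_chord _ (1/4) (dot z z) _); last lra.
rewrite ler_expR.
have := dotvv_ge0 (2 *: v - z).
rewrite dotBl !dotBr !dotZl !dotZr (dotC z v); lra.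
Qed.

(** Expanding the square leaves exp of 2 a x . z + a |z|^2.  The two terms are
    dependent, so they are separated by exp ((U + V)/2) <= (exp U + exp V)/2,
    after subtracting from each the exponent that normalizes it: with
    v = 4 a x, 2 |v|^2 = 32 a^2 |x|^2 for the first one and 2 a for the
    second one.  Half of these is what remains in the factor on the right. *)
Lemma expR_sqr_step (a : R) x : 0 <= a <= 1/2 ->
  exists kappa rho : R, 0 <= rho <= 1 /\
  forall z, expR (a * dot (x + z) (x + z)) <=
    expR (a * (1 + 16 * a) * dot x x + a) *
    (kappa * dot x z + (1 - rho + rho * expR (dot z z - 1))).
Proof.
move=> /andP[a0 a1].
have [k [r [/andP[r0 r1] h]]] := expR_dot_bound ((4 * a) *: x).
exists (2 * a * k), ((r + 2 * a) / 2); split=> [|z]; first by apply/andP; split; lra.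
have {h} := h z; rewrite !dotZl dotZr => h1.
have := @expR_chord _ (2 * a) (dot z z) _.
case/(_ _)/wrap; first by apply/andP; split; lra.
move=> h2.
set U := _ - _ in h1; set V := 2 * a * _ in h2.
have -> : a * dot (x + z) (x + z) = a * (1 + 16 * a) * dot x x + a + (U + V) / 2.
  by rewrite dotDl !dotDr (dotC z x) /U /V; field.
rewrite [leLHS]expRD ler_pM2l ?expR_gt0//.
have h3 : expR ((U + V) / 2) <= (expR U + expR V) / 2.
  have -> : expR U = expR (U/2) * expR (U/2) by rewrite -expRD; congr expR; field.
  have -> : expR V = expR (V/2) * expR (V/2) by rewrite -expRD; congr expR; field.
  rewrite mulrDl expRD; have := sqr_ge0 (expR (U/2) - expR (V/2)); nra.
apply: (le_trans h3); lra.
Qed.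

End one_step.

(** * Descent of inexact gradient steps *)

Section descent.
Context {R : realType} {d : nat} (f : 'rV[R]_d -> R).
Implicit Types x h : 'rV[R]_d.

Lemma derive_dot_grad x h : differentiable f x -> 'D_h f x = dot (grad f x) h.
Proof.
move=> df; rewrite deriveE// {1}(row_sum_delta h) linear_sum.
apply: eq_bigr => i _; rewrite linearZ mxE deriveE//.
by rewrite mulrC.
Qed.

Lemma is_derive_line x h (t : R) : differentiable f (x + t *: h) ->
  is_derive t 1 (fun s : R => f (x + s *: h)) (dot (grad f (x + t *: h)) h).
Proof.
move=> df; have E : (fun s : R => s^-1 *: (((fun s : R => f (x + s *: h)) \o shift t) (s *: 1) - f (x + t *: h))) =
  (fun s : R => s^-1 *: ((f \o shift (x + t *: h)) (s *: h) - f (x + t *: h))).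
  apply/funext => s /=; congr (_ *: (f _ - _)).
  by rewrite [s *: 1]mulr1 scalerDl addrCA.
apply: DeriveDef.
  rewrite /derivable E; exact: (@diff_derivable _ _ _ f (x + t *: h) h).
by rewrite /derive E -derive_dot_grad.
Qed.

Hypothesis df : forall x, differentiable f x.
Variable L : R.
Hypothesis smooth : forall x y,
  l2norm (grad f x - grad f y) <= L * l2norm (x - y).

(** The difference of the two sides, along the segment from x to x + h, starts
    at 0 and has nonpositive derivative. *)
Lemma smooth_quadratic_bound x h :
  f (x + h) <= f x + dot (grad f x) h + L / 2 * dot h h.
Proof.
set A := dot (grad f x) h; set B := L / 2 * dot h h.
pose psi : R -> R := (fun s : R => f (x + s *: h)) - (A \*: id + B \*: (id ^+ 2)).
have psiE s : psi s = f (x + s *: h) - (A * s + B * s ^+ 2) by [].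
have dpsi (s : R) : is_derive s 1 psi
    (dot (grad f (x + s *: h)) h - (A + s * (L * dot h h))).
  have ? := @is_derive_line x h s (df _).
  apply: is_derive_eq; congr (_ - _).
  rewrite -[_ *: (_ *: _)]/(B * (2%:R * s ^+ 1 * 1)) -[_ *: _]/(A * 1) mulr1 expr1.
  by rewrite /B; field.
have [] := @MVT R psi (fun s => dot (grad f (x + s *: h)) h - (A + s * (L * dot h h))) 0 1.
- exact: ltr01.
- apply: derivable_within_continuous => s _; exact: ex_derive.
move=> c; rewrite in_itv /= => /andP[c0 c1].
rewrite !psiE subr0 mulr1 scale1r scale0r addr0 expr1n expr0n/= !mulr0 !mulr1 addr0 subr0.
suff : dot (grad f (x + c *: h) - grad f x) h <= c * (L * dot h h).
  rewrite dotBl -/A /B; lra.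
apply: le_trans (dot_le_l2norm _ _) _.
rewrite -sqr_l2norm expr2 (mulrA L) (mulrA c) ler_wpM2r ?l2norm_ge0//.
apply: le_trans (smooth _ _) _.
by rewrite addrC addKr l2normZ ?(ltW c0)// mulrCA.
Qed.

Hypothesis L0 : 0 < L.

(** With step-size 1/(2L), the quadratic bound and the right-hand side differ by
    |G + e|^2 / (8L), where G is the gradient at x. *)
Lemma inexact_gradient_step (x e : 'rV[R]_d) :
  f (x - (1 / (2 * L)) *: (grad f x + e)) <=
  f x - (dot (grad f x) (grad f x) - dot e e) / (4 * L).
Proof.
rewrite -scaleNr; apply: le_trans (smooth_quadratic_bound x _) _.
rewrite !dotZr dotZl !dotDr !dotDl (dotC e (grad f x)).
have := dotvv_ge0 (grad f x + e); rewrite dotDl !dotDr (dotC e (grad f x)).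
set A := dot (grad f x) _; set C := dot (grad f x) e; set B := dot e e => ABC.
rewrite -subr_ge0.
rewrite (_ : _ - _ = (A + C + (C + B)) / (8 * L)); last first.
  by field; rewrite lt0r_neq0.
by rewrite divr_ge0// mulr_ge0// ltW.
Qed.

Context {Xi : Type} (g : 'rV[R]_d -> Xi -> 'rV[R]_d) (H : nat)
  (x0 xstar : 'rV[R]_d) (s : nat -> Xi).
Hypothesis min_xstar : forall x, f xstar <= f x.

Let x_ := batched_sgd g H (1 / (2 * L)) x0 s.
Let e_ k := batch_gradient g H s k (x_ k) - grad f (x_ k).

Lemma sum_sqr_grad_batched_sgd K :
  \sum_(k < K) dot (grad f (x_ k)) (grad f (x_ k)) <=
  4 * L * (f x0 - f xstar) + \sum_(k < K) dot (e_ k) (e_ k).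
Proof.
(* the induction needs the value at the last iterate instead of the minimum *)
suff : \sum_(k < K) dot (grad f (x_ k)) (grad f (x_ k)) <=
    4 * L * (f x0 - f (x_ K)) + \sum_(k < K) dot (e_ k) (e_ k).
  move=> /le_trans; apply; rewrite lerD2r ler_pM2l ?mulr_gt0//.
  by rewrite lerD2l lerN2.
elim: K => [|K IH]; first by rewrite !big_ord0 subrr mulr0 addr0.
rewrite !big_ord_recr /=.
have := inexact_gradient_step (x_ K) (e_ K).
rewrite {1}/e_ addrCA subrr addr0 -[_ - _ *: _]/(x_ K.+1).
set A := dot (grad f _) _; set B := dot _ _ => step.
have {}step : 4 * L * f (x_ K.+1) <= 4 * L * f (x_ K) - (A - B).
  rewrite (_ : _ - (A - B) = 4 * L * (f (x_ K) - (A - B) / (4 * L))).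
    by rewrite ler_pM2l ?mulr_gt0.
  by field; rewrite lt0r_neq0.
move: IH; rewrite !mulrBr; lra.
Qed.

End descent.

(** * Borel measurability in row spaces *)

Section borel_rV_theory.
Context {R : realType} {d : nat}.

Lemma continuous_measurable_borel_rV (h : 'rV[R]_d -> R) :
  continuous h -> measurable_fun [set: borel_rV R d] h.
Proof.
move=> /continuousP ch; apply: (measurability _ (RGenOpens.measurableE R)).
move=> _ [_ [a [b ->] <-]]; rewrite setTI; apply: sub_gen_smallest.
exact/ch/interval_open.
Qed.

Lemma measurable_coord (i : 'I_d) :
  measurable_fun [set: borel_rV R d] (fun x : 'rV[R]_d => x 0 i).
Proof. by apply: continuous_measurable_borel_rV => x; exact: coord_continuous. Qed.

Definition rat_box (ab : 'rV[rat]_d * 'rV[rat]_d) : set 'rV[R]_d :=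
  [set x | forall i, ratr (ab.1 0 i) < x 0 i < ratr (ab.2 0 i)].

(** Second countability, which reduces Borel sets to countably many boxes and
    hence to coordinates. *)
Lemma open_rV_bigcup_rat_box (U : set 'rV[R]_d) : open U ->
  U = \bigcup_(ab in [set ab | rat_box ab `<=` U]) rat_box ab.
Proof.
move=> oU; apply/seteqP; split; last by move=> x [ab /= abU] xab; exact: abU.
move=> x Ux; have /nbhs_ballP[e /= e0 xeU] : nbhs x U by apply: open_nbhs_nbhs.
have hab i : exists ab : rat * rat, x 0 i - e < ratr ab.1 < x 0 i /\
    x 0 i < ratr ab.2 < x 0 i + e.
  have [a] := @rat_in_itvoo R (x 0 i - e) (x 0 i) ltac:(lra).
  have [b] := @rat_in_itvoo R (x 0 i) (x 0 i + e) ltac:(lra).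
  by rewrite !in_itv /= => hb ha; exists (a, b).
have [ab abP] := fin_all_exists hab.
exists (\row_i (ab i).1, \row_i (ab i).2) => /=; last first.
  by move=> i; rewrite !mxE; have [/andP[_ ->] /andP[->]] := abP i.
move=> y yab; apply: xeU; split=> // j i; rewrite (ord1 j).
have := yab i; rewrite !mxE => /andP[h1 h2].
have [/andP[h3 _] /andP[_ h4]] := abP i.
by rewrite /ball/= ltr_norml; apply/andP; split; lra.
Qed.

Lemma measurable_fun_borel_rV {dT} {T : measurableType dT} (h : T -> 'rV[R]_d) :
  (forall i, measurable_fun [set: T] (fun t => h t 0 i)) ->
  measurable_fun [set: T] (h : T -> borel_rV R d).
Proof.
move=> mh; apply: (@measurability _ _ _ (borel_rV R d) _ _ (@open 'rV[R]_d)) => //.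
move=> _ [U oU <-]; rewrite (open_rV_bigcup_rat_box _ oU) preimage_bigcup setTI.
rewrite bigcup_mkcond.
apply: countable_bigcupT_measurable => [|ab]; first exact: countableP.
case: ifPn => // _.
rewrite (_ : _ @^-1` _ = \bigcap_(i : 'I_d)
    ((fun t => h t 0 i) @^-1` `]ratr (ab.1 0 i), ratr (ab.2 0 i)[)).
  apply: fin_bigcap_measurable; first exact: finite_finset.
  move=> i _; rewrite -[X in measurable X]setTI.
  by apply: mh => //; exact: measurable_itv.
apply/seteqP; split=> t /= H i; first by move=> _; rewrite /= in_itv; exact: H.
by have := H i I; rewrite /= in_itv.
Qed.

End borel_rV_theory.

Section measurable_dot.
Context {R : realType} {d : nat} {dT : measure_display} {T : measurableType dT}.
Implicit Types u v : T -> 'rV[R]_d.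

Lemma measurable_rV_coord u : measurable_fun [set: T] (u : T -> borel_rV R d) ->
  forall i, measurable_fun [set: T] (fun t => u t 0 i).
Proof.
move=> mu i.
exact: (@measurableT_comp _ _ _ _ _ _
  (fun x : borel_rV R d => (x : 'rV[R]_d) 0 i) _ u (measurable_coord i) mu).
Qed.

Lemma measurable_rV_add u v : measurable_fun [set: T] (u : T -> borel_rV R d) ->
  measurable_fun [set: T] (v : T -> borel_rV R d) ->
  measurable_fun [set: T] ((fun t => u t + v t) : T -> borel_rV R d).
Proof.
move=> mu mv; apply: measurable_fun_borel_rV => i.
under eq_fun do rewrite mxE.
by apply: measurable_funD; exact: measurable_rV_coord.
Qed.

Lemma measurable_rV_scale (a : R) u :
  measurable_fun [set: T] (u : T -> borel_rV R d) ->
  measurable_fun [set: T] ((fun t => a *: u t) : T -> borel_rV R d).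
Proof.
move=> mu; apply: measurable_fun_borel_rV => i.
under eq_fun do rewrite mxE.
by apply: measurable_funM => //; exact: measurable_rV_coord.
Qed.

Lemma measurable_dot u v : measurable_fun [set: T] (u : T -> borel_rV R d) ->
  measurable_fun [set: T] (v : T -> borel_rV R d) ->
  measurable_fun [set: T] (fun t => dot (u t) (v t)).
Proof.
move=> mu mv; apply: measurable_sum => i.
by apply: measurable_funM; exact: measurable_rV_coord.
Qed.

End measurable_dot.

Section l2norm_comparison.
Context {R : realType} {d : nat}.

Lemma coord_le_l2norm (u : 'rV[R]_d) i : `|u 0 i| <= l2norm u.
Proof.
rewrite -sqrtr_sqr ler_sqrt; last by apply: sumr_ge0 => j _; exact: sqr_ge0.
by rewrite (bigD1 i)//= lerDl; apply: sumr_ge0 => j _; exact: sqr_ge0.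
Qed.

Lemma l2norm_le_norm (u : 'rV[R]_d) : l2norm u <= d%:R * `|u|.
Proof.
rewrite le_l2norm_dot ?mulr_ge0//.
apply: (@le_trans _ _ (\sum_(i < d) `|u| ^+ 2)).
  apply: ler_sum => i _; rewrite -expr2 -real_normK ?num_real//.
  rewrite ler_sqr ?nnegrE//.
  rewrite [leRHS]/Num.norm /= mx_normrE.
  by apply/bigmax_geP; right => /=; exists (0, i).
rewrite sumr_const card_ord -[leLHS]mulr_natl exprMn ler_wpM2r ?sqr_ge0//.
by rewrite -natrX ler_nat; case: d => // n; rewrite expnS leq_pmulr// expn_gt0.
Qed.

End l2norm_comparison.

(** Lipschitz maps for the Euclidean norm are continuous for the topology of the
    sup norm, since the two norms are comparable. *)
Lemma measurable_l2_lipschitz {R : realType} {d n : nat} (h : 'rV[R]_d -> 'rV[R]_n) (L : R) :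
  (forall x y, l2norm (h x - h y) <= L * l2norm (x - y)) ->
  measurable_fun [set: borel_rV R d] (h : borel_rV R d -> borel_rV R n).
Proof.
move=> hL; apply: measurable_fun_borel_rV => i.
apply: continuous_measurable_borel_rV => x.
pose M := `|L| * d%:R + 1.
have M0 : 0 < M by rewrite ltr_wpDl// mulr_ge0.
apply/(@cvgrPdist_le _ _ _ _ (nbhs_filter x)) => e e0.
apply/nbhs_ballP; exists (e / M); first by rewrite /= divr_gt0.
move=> y; rewrite -ball_normE /= => /ltW xy.
have -> : h x 0 i - h y 0 i = (h x - h y) 0 i by rewrite !mxE.
apply: (le_trans (coord_le_l2norm _ _)); apply: (le_trans (hL _ _)).
apply: (@le_trans _ _ (M * `|x - y|)).
  apply: (@le_trans _ _ (`|L| * (d%:R * `|x - y|))).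
    apply: (@le_trans _ _ (`|L| * l2norm (x - y))).
      by rewrite ler_wpM2r ?l2norm_ge0// ler_norm.
    by rewrite ler_wpM2l// l2norm_le_norm.
  by rewrite mulrA ler_wpM2r// lerDl.
by rewrite mulrC -ler_pdivlMr.
Qed.

(** * Independence of a sample from the past *)

Section past.
Context {R : realType} {dO dX : measure_display} {Omega : measurableType dO}
  {Xi : measurableType dX} {P : probability Omega R}
  (xi : nat -> {RV P >-> Xi}).

Definition cylinders (t : nat) : set (set Omega) :=
  [set C | exists2 A : nat -> set Xi, (forall i, measurable (A i)) &
    C = \bigcap_(i < t) (xi i @^-1` A i)].

(** The sigma-algebra generated by the samples of index less than [t]. *)
Definition past (t : nat) := g_sigma_algebraType (cylinders t).

Lemma measurable_RV_preimage (V : {RV P >-> Xi}) (A : set Xi) :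
  measurable A -> measurable (V @^-1` A).
Proof. by move=> mA; rewrite -[X in measurable X]setTI; exact: measurable_funP. Qed.

Lemma cylinders_setI t : setI_closed (cylinders t).
Proof.
move=> _ _ [A mA ->] [B mB ->]; exists (fun i => A i `&` B i).
  by move=> i; exact: measurableI.
by rewrite -bigcapI; apply: eq_bigcapr => i _; rewrite preimage_setI.
Qed.

Lemma cylindersT t : cylinders t setT.
Proof.
exists (fun=> setT) => [//|].
by apply/esym; rewrite -subTset => w _ i _.
Qed.

Lemma cylinders_measurable t : cylinders t `<=` measurable.
Proof.
move=> _ [A mA ->]; apply: bigcap_measurableType => i _.
exact: measurable_RV_preimage.
Qed.

Lemma past_measurable t (B : set Omega) :
  measurable (B : set (past t)) -> measurable B.
Proof.
apply: smallest_sub; first exact: sigma_algebra_measurable.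
exact: cylinders_measurable.
Qed.

Lemma past_measurable_fun t d' (T : measurableType d') (U : Omega -> T) :
  measurable_fun [set: past t] U -> measurable_fun [set: Omega] U.
Proof.
move=> mU _ B mB; apply: (@past_measurable t); exact: mU.
Qed.

Lemma cylinders_leq s t : (s <= t)%N -> cylinders s `<=` cylinders t.
Proof.
move=> st _ [A mA ->]; exists (fun i => if (i < s)%N then A i else setT).
  by move=> i; case: ifP.
apply/seteqP; split=> w /= H i /= it.
  by case: ifPn => // ilts; exact: H.
by have := H i (leq_trans it st); rewrite /= it.
Qed.

Lemma past_leq_fun s t d' (T : measurableType d') (U : Omega -> T) :
  (s <= t)%N -> measurable_fun [set: past s] U -> measurable_fun [set: past t] U.
Proof.
move=> st mU _ B mB; have := mU measurableT B mB.
by apply: sub_smallest2r; [exact: smallest_sigma_algebra|exact: cylinders_leq].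
Qed.

Lemma past_sample s t : (s < t)%N -> measurable_fun [set: past t] (xi s : Omega -> Xi).
Proof.
move=> st _ B mB; rewrite setTI; apply: sub_gen_smallest.
exists (fun i => if i == s then B else setT) => [i|]; first by case: ifP.
apply/seteqP; split=> w /= H; last by have := H s st; rewrite /= eqxx.
by move=> i _ /=; case: ifPn => // /eqP ->.
Qed.

Variables (n : nat).
Hypothesis ind : mutually_independent (fun i : 'I_n => xi i).

Lemma cylinder_indep t (A : nat -> set Xi) : (t <= n)%N ->
  (forall i, measurable (A i)) ->
  P (\bigcap_(i < t) (xi i @^-1` A i)) =
  (\prod_(i < t) P (xi i @^-1` A i))%E.
Proof.
move=> tn mA.
have := ind (finset (fun i : 'I_n => (i < t)%N)) (fun i => A i) (fun i => mA i).
rewrite (big_ord_widen n (fun i => P (xi i @^-1` A i)) tn).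
under eq_bigl do rewrite inE.
move=> <-; congr (P _); apply/seteqP; split=> w /= H i /=; rewrite ?inE => it.
  exact: H.
by have := H (Ordinal (leq_trans it tn)); rewrite /= inE; exact.
Qed.

(** Two finite measures, restriction of P to the event on sample [t] and
    multiplication of P by its probability, agree on the pi-system of cylinders
    by independence, hence on the sigma-algebra it generates. *)
Lemma past_indep t (B : set Omega) (A : set Xi) : (t < n)%N ->
  measurable (B : set (past t)) -> measurable A ->
  P (B `&` xi t @^-1` A) = (P B * P (xi t @^-1` A))%E.
Proof.
move=> tn mB mA.
have mE := @measurable_RV_preimage (xi t) _ mA.
set E := xi t @^-1` A in mE *.
have fE : P E \is a fin_num by exact: fin_num_measure.
have E0 : 0 <= fine (P E) by exact: fine_ge0.
have scaleE C : mscale (NngNum E0) P C = (P C * P E)%E.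
  by rewrite /mscale /= fineK// muleC.
rewrite -scaleE -[LHS]/(mrestr P mE B).
apply: (g_sigma_algebra_measure_unique (cylinders t)
  (@cylinders_measurable t) (fun=> setT) (fun=> cylindersT t)) => //.
- by rewrite bigcup_const.
- exact: cylinders_setI.
- move=> _ [C mC ->]; rewrite [RHS]scaleE; set D := \bigcap_(_ < t) _.
  rewrite -[LHS]/(P (D `&` E)) {}/D.
  (* the intersection is itself a cylinder, on one more sample *)
  pose C' i := if (i < t)%N then C i else A.
  have mC' i : measurable (C' i) by rewrite /C'; case: ifP.
  transitivity (P (\bigcap_(i < t.+1) (xi i @^-1` C' i))).
    congr (P _); apply/seteqP; split=> w /=.
      move=> [H wA] i /=; rewrite ltnS /C' => it.
      case: ltnP => [|ti]; first exact: H.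
      by have -> : i = t by apply/eqP; rewrite eqn_leq it.
    move=> H; split=> [i /= it|].
      by have := H i (ltnW it); rewrite /= /C' it.
    by have := H t (ltnSn t); rewrite /= /C' ltnn.
  rewrite cylinder_indep// cylinder_indep//; last exact: ltnW.
  rewrite big_ord_recr /= /C' ltnn; congr (_ * _)%E.
  by apply: eq_bigr => i _; rewrite ltn_ord.
- by move=> _; rewrite /= /mrestr setTI ltey_eq fE.
Qed.

End past.

(** The joint law of independent [U] and [V] is the product of their laws, so
    [U] may be frozen while integrating over [V]. *)
Lemma integral_freezing {R : realType} {dO dA dX : measure_display}
    {Omega : measurableType dO} {A : measurableType dA} {Xi : measurableType dX}
    (P : probability Omega R) (mu : probability Xi R)
    (U : {RV P >-> A}) (V : {RV P >-> Xi}) (F : A * Xi -> \bar R) :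
  (forall B C, measurable B -> measurable C ->
    P (U @^-1` B `&` V @^-1` C) = (P (U @^-1` B) * mu C)%E) ->
  measurable_fun [set: A * Xi] F -> (forall z, (0 <= F z)%E) ->
  (\int[P]_w F (U w, V w) = \int[P]_w \int[mu]_z F (U w, z))%E.
Proof.
move=> UV mF F0.
have mW : measurable_fun [set: Omega] (fun w => (U w, V w)).
  by apply: measurable_fun_pair.
pose Wm := isMeasurableFun.Build _ _ _ _ _ mW.
pose W : {RV P >-> (A * Xi)%type} := HB.pack (fun w => (U w, V w)) Wm.
rewrite -[LHS](@ge0_integral_distribution _ _ _ _ _ P W)//.
rewrite (@eq_measure_integral _ _ _ _ (distribution P U \x mu)%E); last first.
  by move=> B mB _; apply/esym; apply: product_measure_unique.
rewrite fubini_tonelli1// ge0_integral_distribution//.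
  exact: measurable_fun_fubini_tonelli_F.
by move=> y; apply: integral_ge0.
Qed.

(** * Exponential moments of sums of noise vectors *)

Section one_step_expectation.
Context {R : realType} {d : nat} {dX : measure_display} {Xi : measurableType dX}.
Variables (mu : probability Xi R) (zeta : Xi -> 'rV[R]_d).
Hypothesis mz : measurable_fun [set: Xi] (zeta : Xi -> borel_rV R d).
Hypothesis zeta_sub :
  (\int[mu]_z (expR (dot (zeta z) (zeta z)))%:E <= (expR 1)%:E)%E.

Lemma integrable_expR_dot :
  mu.-integrable setT (fun z => (expR (dot (zeta z) (zeta z)))%:E).
Proof.
apply/integrableP; split.
  by apply/measurable_EFinP; apply: measurableT_comp => //; exact: measurable_dot.
under eq_integral do rewrite gee0_abs ?lee_fin ?expR_ge0//.
by apply: le_lt_trans zeta_sub _; rewrite ltry.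
Qed.

(** A coordinate is dominated by exp of the squared norm: |t| <= 1 + t^2. *)
Lemma integrable_coord_noise i : mu.-integrable setT (fun z => (zeta z 0 i)%:E).
Proof.
apply: le_integrable integrable_expR_dot => //.
  by apply/measurable_EFinP; exact: measurable_rV_coord.
move=> z _; rewrite lee_fin [leRHS]ger0_norm ?expR_ge0//.
have := expR_ge1Dx (dot (zeta z) (zeta z)).
have : `|zeta z 0 i| ^+ 2 <= dot (zeta z) (zeta z).
  by rewrite -sqr_l2norm ler_sqr ?nnegrE ?l2norm_ge0 ?coord_le_l2norm.
have := sqr_ge0 (`|zeta z 0 i| - 1); nra.
Qed.

Hypothesis zeta_mean0 : forall i, (\int[mu]_z (zeta z 0 i)%:E = 0)%E.

Lemma integrable_dot_noise x : mu.-integrable setT (fun z => (dot x (zeta z))%:E).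
Proof.
under eq_fun do rewrite -sumEFin.
apply: integrable_sum => // i _; under eq_fun do rewrite EFinM.
by apply: integrableZl => //; exact: integrable_coord_noise.
Qed.

Lemma integral_dot_noise x : (\int[mu]_z (dot x (zeta z))%:E = 0)%E.
Proof.
under eq_integral do rewrite -sumEFin.
rewrite integral_sum//; last first.
  move=> i; under eq_fun do rewrite EFinM.
  by apply: integrableZl => //; exact: integrable_coord_noise.
rewrite big1// => i _; under eq_integral do rewrite EFinM.
by rewrite integralZl ?zeta_mean0 ?mule0//; exact: integrable_coord_noise.
Qed.

(** The integral of the pointwise bound [expR_sqr_step]: the linear term vanishes
    and the rest is at most 1 times the constant factor. *)
Lemma integral_expR_sqr_step (a : R) (x : 'rV[R]_d) : 0 <= a <= 1/2 ->
  (\int[mu]_z (expR (a * dot (x + zeta z) (x + zeta z)))%:E <=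
   (expR (a * (1 + 16 * a) * dot x x + a))%:E)%E.
Proof.
move=> a01; have [k [r [/andP[r0 r1] h]]] := expR_sqr_step a x a01.
set M := expR _ in h *.
have M0 : 0 < M by exact: expR_gt0.
have i1 : mu.-integrable setT (fun z => (M * k)%:E * (dot x (zeta z))%:E)%E.
  by apply: integrableZl => //; exact: integrable_dot_noise.
have i2 : mu.-integrable setT (fun z => (M * (1 - r))%:E)%E.
  exact: finite_measure_integrable_cst.
have i3 : mu.-integrable setT
    (fun z => (M * r * expR (-1))%:E * (expR (dot (zeta z) (zeta z)))%:E)%E.
  by apply: integrableZl => //; exact: integrable_expR_dot.
apply: (@le_trans _ _ (\int[mu]_z ((M * k)%:E * (dot x (zeta z))%:E +
  ((M * (1 - r))%:E +
   (M * r * expR (-1))%:E * (expR (dot (zeta z) (zeta z)))%:E)))%E).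
  have le_z z : ((expR (a * dot (x + zeta z) (x + zeta z)))%:E <=
      (M * k)%:E * (dot x (zeta z))%:E + ((M * (1 - r))%:E +
      (M * r * expR (-1))%:E * (expR (dot (zeta z) (zeta z)))%:E))%E.
    rewrite -!EFinM -!EFinD lee_fin; apply: (le_trans (h (zeta z))).
    by rewrite expRD le_eqVlt; apply/orP; left; apply/eqP; ring.
  apply: ge0_le_integral => //.
  - apply/measurable_EFinP; apply: measurableT_comp => //.
    by apply: measurable_funM => //; apply: measurable_dot; exact: measurable_rV_add.
  - by apply: (measurable_int mu); apply: integrableD => //; exact: integrableD.
rewrite integralD//; last exact: integrableD.
rewrite integralD// integralZl//; last exact: integrable_dot_noise.
rewrite integral_dot_noise mule0 add0e integral_cst//= probability_setT mule1.
rewrite integralZl//; last exact: integrable_expR_dot.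
apply: (@le_trans _ _ ((M * (1 - r))%:E + (M * r * expR (-1))%:E * (expR 1)%:E)%E).
  by rewrite leeD2l// lee_wpmul2l// lee_fin !mulr_ge0 ?expR_ge0// ltW.
rewrite -EFinM -EFinD lee_fin -(mulrA (M * r)) -expRD addNr expR0 mulr1; lra.
Qed.

End one_step_expectation.

Section partial_sum.
Context {R : realType} {d : nat} {dO dX : measure_display}
  {Omega : measurableType dO} {Xi : measurableType dX} {P : probability Omega R}.
Variables (xi : nat -> {RV P >-> Xi}).
(** A vector field depending on a sample, to be summed along fresh samples while
    its first argument stays at the random point [X], known at time [t0]. *)
Variable E : 'rV[R]_d -> Xi -> 'rV[R]_d.
Hypothesis mE : measurable_fun [set: borel_rV R d * Xi]
  (fun z : borel_rV R d * Xi => E z.1 z.2 : borel_rV R d).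
Variables (t0 : nat) (X : Omega -> 'rV[R]_d).
Hypothesis mX : measurable_fun [set: past xi t0] (X : Omega -> borel_rV R d).

Definition partial_sum (l : nat) (w : Omega) : 'rV[R]_d :=
  \sum_(j < l) E (X w) (xi (t0 + j)%N w).

Lemma measurable_partial_sum l : measurable_fun [set: past xi (t0 + l)]
  (partial_sum l : Omega -> borel_rV R d).
Proof.
elim: l => [|l IH].
  rewrite /partial_sum; under eq_fun do rewrite big_ord0; exact: measurable_cst.
rewrite /partial_sum; under eq_fun do rewrite big_ord_recr /=.
apply: (@measurable_rV_add _ _ _ (past xi (t0 + l.+1))).
  by apply: past_leq_fun IH; rewrite addnS.
have mpair : measurable_fun [set: past xi (t0 + l.+1)]
    (fun w : Omega => (X w : borel_rV R d, xi (t0 + l)%N w)).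
  apply: measurable_fun_pair.
    by apply: past_leq_fun mX; rewrite leq_addr.
  by apply: past_sample; rewrite addnS.
exact: (measurableT_comp mE mpair).
Qed.

Variables (mu : probability Xi R) (n : nat).
Hypothesis iid : iid_samples mu n xi.

Lemma integral_freezing_past t (dA : measure_display) (A : measurableType dA)
    (U : Omega -> A) (F : A * Xi -> \bar R) : (t < n)%N ->
  measurable_fun [set: past xi t] U ->
  measurable_fun [set: A * Xi] F -> (forall z, (0 <= F z)%E) ->
  (\int[P]_w F (U w, xi t w) = \int[P]_w \int[mu]_z F (U w, z))%E.
Proof.
move=> tn mU mF F0; have mU' := past_measurable_fun _ _ _ _ _ mU.
pose Um := isMeasurableFun.Build _ _ _ _ _ mU'.
pose V : {RV P >-> A} := HB.pack U Um.
apply: (@integral_freezing _ _ _ _ _ _ _ P mu V (xi t)) => // B C mB mC.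
have [law ind] := iid.
rewrite (past_indep _ _ ind)//; last by rewrite -[X in measurable X]setTI; exact: mU.
by congr (_ * _)%E; exact: law.
Qed.

Hypothesis E_mean0 : forall x i, (\int[mu]_z (E x z 0 i)%:E = 0)%E.
Hypothesis E_sub : forall x,
  (\int[mu]_z (expR (dot (E x z) (E x z)))%:E <= (expR 1)%:E)%E.

(** The weights a_l = 1 / (16 (H + l)) satisfy
    a_(l+1) (1 + 16 a_(l+1)) <= a_l, so that passing from l to l + 1 only costs
    the factor exp a_(l+1) <= exp (1 / (16 H)).  Starting the weights at H rather
    than at 0 keeps the product of these factors bounded for l <= H. *)
Lemma integral_expR_partial_sum H l : (0 < H)%N -> (l <= H)%N -> (t0 + l <= n)%N ->
  (\int[P]_w (expR ((16 * (H + l)%:R)^-1 *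
     dot (partial_sum l w) (partial_sum l w)))%:E <=
   (expR (l%:R / (16 * H%:R)))%:E)%E.
Proof.
move=> H0; elim: l => [_ _|l IH lH ln].
  rewrite /partial_sum; under eq_integral do rewrite big_ord0 dot0r mulr0 expR0.
  by rewrite integral_cst//= probability_setT mule1 mul0r expR0.
have {}IH := IH (ltnW lH) ltac:(by rewrite (leq_trans _ ln)// addnS).
set a : R := (16 * (H + l.+1)%:R)^-1.
have HR : 1 <= H%:R :> R by rewrite ler1n.
have a0 : 0 < a by rewrite invr_gt0 mulr_gt0// ltr0n addnS.
have am : a * (1 + 16 * a) <= (16 * (H + l)%:R)^-1.
  have m0 : 0 < (H + l)%:R :> R by rewrite ltr0n addn_gt0 H0.
  rewrite /a addnS -[(H + l).+1%:R]natr1; move: (H + l)%:R m0 => m m0.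
  have m1 : 0 < m + 1 by rewrite addr_gt0.
  rewrite -subr_ge0 (_ : _ - _ = (16 * m * (m + 1) ^+ 2)^-1).
    by rewrite invr_ge0 ltW// !mulr_gt0// exprn_gt0.
  by field; rewrite !lt0r_neq0.
have aH : a <= (16 * H%:R)^-1.
  rewrite lef_pV2 ?posrE ?mulr_gt0 ?ltr0n ?addnS//.
  by rewrite ler_pM2l// ler_nat -addnS leq_addr.
have a12 : 0 <= a <= 1/2.
  rewrite ltW//= (le_trans aH)// invfM.
  have : H%:R^-1 <= 1 :> R by rewrite invf_le1// ltr0n.
  lra.
(* the new squared norm as a function of the past (iterate and partial sum) and
   of the next sample *)
pose F (z : (borel_rV R d * borel_rV R d) * Xi) : \bar R :=
  (expR (a * dot ((z.1.2 : 'rV[R]_d) + E z.1.1 z.2)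
                 ((z.1.2 : 'rV[R]_d) + E z.1.1 z.2)))%:E.
have mF : measurable_fun setT F.
  apply/measurable_EFinP; apply: measurableT_comp => //.
  apply: measurable_funM => //.
  suff mv : measurable_fun setT ((fun z : (borel_rV R d * borel_rV R d) * Xi =>
      (z.1.2 : 'rV[R]_d) + E z.1.1 z.2) : _ -> borel_rV R d) by exact: measurable_dot.
  apply: measurable_rV_add.
    exact: (measurableT_comp measurable_snd measurable_fst).
  apply: (measurableT_comp mE (measurable_fun_pair
    (measurableT_comp measurable_fst measurable_fst) measurable_snd)).
have mU : measurable_fun [set: past xi (t0 + l)]
    (fun w : Omega => (X w : borel_rV R d, partial_sum l w : borel_rV R d)).
  apply: measurable_fun_pair; last exact: measurable_partial_sum.
  by apply: past_leq_fun mX; rewrite leq_addr.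
have -> : (\int[P]_w (expR (a * dot (partial_sum l.+1 w) (partial_sum l.+1 w)))%:E =
    \int[P]_w F ((X w, partial_sum l w), xi (t0 + l)%N w))%E.
  by apply: eq_integral => w _; rewrite /F /partial_sum big_ord_recr.
rewrite (@integral_freezing_past (t0 + l) _ _ _ F)//; last first.
- by move=> z; rewrite lee_fin expR_ge0.
- by rewrite (leq_trans _ ln)// addnS.
have m1 : measurable_fun [set: Omega] (fun w => dot (partial_sum l w) (partial_sum l w)).
  have mS := past_measurable_fun _ _ _ _ _ (measurable_partial_sum l).
  exact: measurable_dot.
have m2 (c : R) : measurable_fun [set: Omega]
    (fun w => (expR (c * dot (partial_sum l w) (partial_sum l w)))%:E).
  apply/measurable_EFinP; apply: measurableT_comp => //.
  exact: measurable_funM.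
apply: (@le_trans _ _ (\int[P]_w ((expR a)%:E * (expR ((16 * (H + l)%:R)^-1 *
     dot (partial_sum l w) (partial_sum l w)))%:E))%E).
  apply: ge0_le_integral => //.
  - by move=> w _; apply: integral_ge0 => z _; rewrite lee_fin expR_ge0.
  - have mFF := @measurable_fun_fubini_tonelli_F _ _ _ _ _ mu F mF
      (fun z => expR_ge0 _ : (0 <= F z)%E).
    exact: (measurableT_comp mFF (past_measurable_fun _ _ _ _ _ mU)).
  - exact: measurable_funeM.
  - move=> w _.
    have mEx : measurable_fun [set: Xi] (E (X w) : Xi -> borel_rV R d).
      have mp : measurable_fun [set: Xi] (fun z => (X w : borel_rV R d, z)).
        by apply: measurable_fun_pair.
      exact: (measurableT_comp mE mp).
    apply: (le_trans (integral_expR_sqr_step mu (E (X w)) mEx (E_sub _) (E_mean0 _) a (partial_sum l w) a12)).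
    rewrite -EFinM lee_fin -expRD ler_expR addrC lerD2l.
    by rewrite ler_wpM2r// dotvv_ge0.
rewrite ge0_integralZl//.
apply: (le_trans (lee_wpmul2l _ IH)); first by rewrite lee_fin expR_ge0.
rewrite -EFinM lee_fin -expRD ler_expR -[l.+1%:R]natr1 [leRHS]mulrDl mul1r.
by rewrite addrC lerD2l.
Qed.

End partial_sum.

(** * Batched SGD *)

Lemma measurable_batched_sgd {R : realType} {d : nat} {dO dX : measure_display}
    {Omega : measurableType dO} {Xi : measurableType dX} {P : probability Omega R}
    (xi : nat -> {RV P >-> Xi}) (g : 'rV[R]_d -> Xi -> 'rV[R]_d) (H : nat)
    (alpha : R) (x0 : 'rV[R]_d) (k : nat) :
  measurable_fun [set: borel_rV R d * Xi]
    (fun z : borel_rV R d * Xi => g z.1 z.2 : borel_rV R d) ->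
  measurable_fun [set: past xi (k * H)]
    ((fun w => batched_sgd g H alpha x0 (fun t => xi t w) k) :
       Omega -> borel_rV R d).
Proof.
move=> mg; elim: k => [|k IH]; first exact: measurable_cst.
rewrite mulSnr /=.
under eq_fun do rewrite -scaleNr.
apply: (@measurable_rV_add _ _ _ (past xi (k * H + H))).
  by apply: past_leq_fun IH; rewrite leq_addr.
apply: measurable_rV_scale; apply: measurable_rV_scale.
exact: (measurable_partial_sum xi g mg (k * H) _ IH H).
Qed.

(** Jensen's inequality, from the tangent of exp at the mean. *)
Lemma expR_mean_le {R : realType} (K : nat) (y : 'I_K -> R) : (0 < K)%N ->
  expR (K%:R^-1 * \sum_k y k) <= K%:R^-1 * \sum_k expR (y k).
Proof.
move=> K0; set z := _ * \sum_k y k.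
have KR : 0 < K%:R :> R by rewrite ltr0n.
rewrite mulrC ler_pdivlMr//.
have : \sum_k expR z * (1 + (y k - z)) <= \sum_k expR (y k).
  apply: ler_sum => k _; rewrite -[y k in leRHS](subrKC z) expRD.
  by rewrite ler_pM2l ?expR_gt0// expR_ge1Dx.
rewrite -mulr_sumr big_split/= sumrB !sumr_const card_ord.
rewrite (_ : \sum_(k < K) y k - _ = 0) ?addr0//.
by rewrite -[z *+ K]mulr_natl /z mulrA divff ?lt0r_neq0// mul1r subrr.
Qed.

(** The means of dependent variables are controlled as well as each of them, as
    Jensen's inequality acts inside the expectation. *)
Lemma chernoff_mean {R : realType} {dO : measure_display}
    {Omega : measurableType dO} (P : probability Omega R) (K : nat)
    (Y : nat -> Omega -> R) (b q : R) :
  (0 < K)%N -> (forall k, measurable_fun [set: Omega] (Y k)) ->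
  (forall k, (k < K)%N -> (\int[P]_w (expR (Y k w))%:E <= (expR b)%:E)%E) ->
  (P [set w | (q <= K%:R^-1 * \sum_(k < K) Y k w)%R] <=
   (expR (b - q))%:E)%E.
Proof.
move=> K0 mY EY; have KR : 0 < K%:R :> R by rewrite ltr0n.
pose Z w := K%:R^-1 * \sum_(k < K) Y k w.
have mZ : measurable_fun [set: Omega] Z.
  by apply: measurable_funM => //; exact: measurable_sum.
have EZ : (\int[P]_w (expR (Z w))%:E <= (expR b)%:E)%E.
  have mexpY k : measurable_fun [set: Omega] (fun w => (expR (Y k w))%:E).
    by apply/measurable_EFinP; exact: measurableT_comp.
  have mW : measurable_fun [set: Omega] (fun w => \sum_(k < K) (expR (Y k w))%:E)%E.
    by apply: emeasurable_sum => k; exact: mexpY.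
  apply: (@le_trans _ _
    ((K%:R^-1)%:E * \int[P]_w (\sum_(k < K) (expR (Y k w))%:E))%E).
    rewrite -ge0_integralZl//; last by move=> w _; exact: sume_ge0.
    apply: ge0_le_integral => //.
    - by apply/measurable_EFinP; exact: measurableT_comp.
    - exact: measurable_funeM.
    - by move=> w _; rewrite sumEFin -EFinM lee_fin; exact: expR_mean_le.
  rewrite (@ge0_integral_sum _ _ _ P _ measurableT _ (fun (k : 'I_K) w => (expR (Y k w))%:E))//.
  apply: (@le_trans _ _ ((K%:R^-1)%:E * \sum_(k < K) (expR b)%:E)%E).
    rewrite lee_wpmul2l// ?lee_fin ?invr_ge0 ?(ltW KR)//.
    by apply: lee_sum => k _; exact: EY.
  rewrite sumEFin sumr_const card_ord -EFinM -[expR _ *+ K]mulr_natl mulrA.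
  by rewrite mulVf ?mul1r// lt0r_neq0.
pose Zm := isMeasurableFun.Build _ _ _ _ _ mZ.
pose ZRV : {RV P >-> R} := HB.pack Z Zm.
apply: (le_trans (chernoff ZRV q ltr01)).
rewrite mul1r /mmt_gen_fun unlock expRD EFinM lee_wpmul2r ?lee_fin ?expR_ge0//.
by under eq_integral do rewrite /= mulr1.
Qed.

Theorem theorem2 (R : realType) :
  exists c : R, 0 < c /\
  forall (d : nat) (f : 'rV[R]_d -> R) (xstar : 'rV[R]_d)
    (dX : measure_display) (Xi : measurableType dX) (mu : probability Xi R)
    (g : 'rV[R]_d -> Xi -> 'rV[R]_d) (L sigma : R),
  (0 < d)%N ->
  (forall x, differentiable f x) ->
  (forall x, f xstar <= f x) ->
  measurable_fun [set: borel_rV R d * Xi]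
    (fun z : borel_rV R d * Xi => g z.1 z.2 : borel_rV R d) ->
  0 < L ->
  (forall x y, l2norm (grad f x - grad f y) <= L * l2norm (x - y)) ->
  (forall (x : 'rV[R]_d) (i : 'I_d),
     'E_mu[fun z => (g x z 0 i)%R]%E = (grad f x 0 i)%:E) ->
  0 < sigma ^+ 2 ->
  (forall x : 'rV[R]_d,
     ('E_mu[fun z => (expR (l2norm (g x z - grad f x) ^+ 2 / sigma ^+ 2))%R]
      <= (expR 1)%:E)%E) ->
  forall (dO : measure_display) (Omega : measurableType dO)
    (P : probability Omega R) (T K H : nat) (xi : nat -> {RV P >-> Xi})
    (x0 : 'rV[R]_d) (delta : R),
  (0 < K)%N -> (0 < H)%N -> T = (K * H)%N ->
  K%:R = Num.sqrt (T%:R : R) ->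
  iid_samples mu T xi ->
  0 < delta < 1 ->
  ((1 - delta)%:E <=
   P [set w | (K%:R^-1 * \sum_(k < K)
                 l2norm (grad f (batched_sgd g H (1 / (2 * L)) x0
                                   (fun t => xi t w) k)) ^+ 2
               <= 8 * L * (f x0 - f xstar) / Num.sqrt T%:R
                  + 8 * c ^+ 2 * sigma ^+ 2 / Num.sqrt T%:R
                    * ln (2 * d%:R * T%:R / delta))%R])%E.
Proof.
exists 2; split=> // d f xstar dX Xi mu g L sigma d0 df fmin mg L0 smooth.
move=> unbiased sigma0 subgauss dO Omega P T K H xi x0 delta K0 H0 TKH KT iid.
move=> /andP[delta0 delta1].
have KH : K = H.
  have /eqP : (K%:R : R) ^+ 2 = T%:R by rewrite KT sqr_sqrtr.
  by rewrite -natrX eqr_nat TKH expnS expn1 eqn_pmul2l// => /eqP.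
have KR : 0 < K%:R :> R by rewrite ltr0n.
have HR : 0 < H%:R :> R by rewrite ltr0n.
set x_ := batched_sgd g H (1 / (2 * L)) x0.
pose X k w := x_ (fun t => xi t w) k.
(* sigma itself may be negative *)
pose s : R := Num.sqrt (sigma ^+ 2).
have s0 : 0 < s by rewrite sqrtr_gt0.
have s2 : s ^+ 2 = sigma ^+ 2 by rewrite sqr_sqrtr// ltW.
pose zeta x z := s^-1 *: (g x z - grad f x).
have mgrad : measurable_fun [set: borel_rV R d]
    (grad f : borel_rV R d -> borel_rV R d).
  exact: measurable_l2_lipschitz smooth.
have mzeta : measurable_fun [set: borel_rV R d * Xi]
    (fun z : borel_rV R d * Xi => zeta z.1 z.2 : borel_rV R d).
  apply: measurable_rV_scale; apply: measurable_rV_add => //.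
  under eq_fun do rewrite -scaleN1r; apply: measurable_rV_scale.
  exact: (measurableT_comp mgrad measurable_fst).
have zeta_sub x :
    (\int[mu]_z (expR (dot (zeta x z) (zeta x z)))%:E <= (expR 1)%:E)%E.
  have := subgauss x; rewrite unlock; apply: le_trans.
  rewrite le_eqVlt; apply/orP; left; apply/eqP; apply: eq_integral => z _.
  rewrite sqr_l2norm /zeta dotZl dotZr -s2; congr (expR _)%:E.
  by field; rewrite lt0r_neq0.
have mzx x : measurable_fun [set: Xi] (zeta x : Xi -> borel_rV R d).
  have mp : measurable_fun [set: Xi] (fun z => (x : borel_rV R d, z)).
    by apply: measurable_fun_pair.
  exact: (measurableT_comp mzeta mp).
have zeta_mean0 x i : (\int[mu]_z (zeta x z 0 i)%:E = 0)%E.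
  have iz := integrable_coord_noise mu (zeta x) (mzx x) (zeta_sub x) i.
  have := unbiased x i; rewrite unlock.
  have gE z : ((g x z 0 i)%:E = s%:E * (zeta x z 0 i)%:E + (grad f x 0 i)%:E)%E.
    rewrite -EFinM -EFinD /zeta !mxE; congr _%:E.
    by field; rewrite lt0r_neq0.
  under eq_integral do rewrite gE.
  rewrite integralD//; last 2 first.
  - exact: integrableZl.
  - exact: finite_measure_integrable_cst.
  rewrite integralZl// integral_cst//= probability_setT mule1.
  have := integrable_fin_num measurableT iz.
  case: (\int[mu]_z _)%E => //= r _ [] h.
  by congr _%:E; apply/eqP; rewrite -(mulrI_eq0 r (lregP (lt0r_neq0 s0))); lra.
pose S k w := partial_sum xi zeta (k * H) (X k) H w.
have errE k w : batch_gradient g H (fun t => xi t w) k (X k w) - grad f (X k w) =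
    (s / H%:R) *: S k w.
  rewrite /S /partial_sum /zeta /batch_gradient -scaler_sumr scalerA.
  rewrite sumrB sumr_const card_ord -[grad f _ *+ H]scaler_nat scalerBr scalerA.
  congr (_ *: _ - _); first by field; rewrite ?lt0r_neq0.
  rewrite -[LHS]scale1r; congr (_ *: _).
  by field; rewrite ?lt0r_neq0.
have mX k : measurable_fun [set: past xi (k * H)] (X k : Omega -> borel_rV R d).
  exact: measurable_batched_sgd.
have mXO k : measurable_fun [set: Omega] (X k : Omega -> borel_rV R d).
  exact: past_measurable_fun (mX k).
(* the exponent of [integral_expR_partial_sum] at the end of the batch, l = H *)
pose Y k w := (16 * (H + H)%:R)^-1 * dot (S k w) (S k w).
have mY k : measurable_fun [set: Omega] (Y k).
  apply: measurable_funM => //; apply: measurable_dot;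
  exact: past_measurable_fun
    (measurable_partial_sum xi zeta mzeta (k * H) (X k) (mX k) H).
have EY k : (k < K)%N -> (\int[P]_w (expR (Y k w))%:E <= (expR (1 / 16))%:E)%E.
  move=> kK.
  have := integral_expR_partial_sum xi zeta mzeta (k * H) (X k) (mX k) mu T iid
    zeta_mean0 zeta_sub H H H0 (leqnn H).
  rewrite (_ : H%:R / (16 * H%:R) = 1 / 16); last by field; rewrite lt0r_neq0.
  apply.
  by rewrite TKH -mulSnr leq_mul2r kK orbT.
pose Z w := K%:R^-1 * \sum_(k < K) Y k w.
have mZ : measurable_fun [set: Omega] Z.
  by apply: measurable_funM => //; exact: measurable_sum.
pose x : R := 2 * d%:R * T%:R / delta.
have dT : 1 <= d%:R * T%:R :> R.
  by rewrite -natrM ler1n muln_gt0 d0 TKH muln_gt0 K0.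
have x_gt0 : 0 < x by rewrite divr_gt0//; lra.
pose bad : set Omega := [set w | ln x <= Z w].
have Pbad : (P bad <= delta%:E)%E.
  apply: (le_trans (chernoff_mean P K Y _ (ln x) K0 mY EY)).
  rewrite lee_fin expRD expRN lnK ?posrE// ler_pdivrMr// /x.
  have e2 : expR (1 / 16) <= 2 :> R.
    have := expR_ge1Dx (- (1 / 16) : R); have := expRxMexpNx_1 (1 / 16 : R).
    have := expR_gt0 (1 / 16 : R); nra.
  rewrite (_ : delta * _ = 2 * (d%:R * T%:R)); last by field; rewrite lt0r_neq0.
  lra.
set A := [set w | _].
have mA : measurable A.
  pose h w := K%:R^-1 * \sum_(k < K) dot (grad f (X k w)) (grad f (X k w)).
  have mh : measurable_fun [set: Omega] h.
    apply: measurable_funM => //; apply: measurable_sum => k.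
    by apply: measurable_dot; exact: (measurableT_comp mgrad (mXO k)).
  rewrite (_ : A = [set: Omega] `&` h @^-1` `]-oo,
      (8 * L * (f x0 - f xstar) / Num.sqrt T%:R +
       8 * 2 ^+ 2 * sigma ^+ 2 / Num.sqrt T%:R * ln x)]).
    by apply: mh => //; exact: measurable_itv.
  rewrite setTI; apply/seteqP; split=> w; rewrite /A /= in_itv /=;
    by under eq_bigr do rewrite sqr_l2norm.
have mbad : measurable bad.
  rewrite (_ : bad = [set: Omega] `&` Z @^-1` `[ln x, +oo[).
    by apply: (mZ) => //; exact: measurable_itv.
  by rewrite setTI; apply/seteqP; split=> w; rewrite /bad /= in_itv /= andbT.
apply: (@le_trans _ _ (P (~` bad))).
  by rewrite probability_setC// EFinB leeB.
apply: le_measure; rewrite ?inE//; first exact: measurableC.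
move=> w /= /negP; rewrite -ltNge => Zx.
have sum_le := sum_sqr_grad_batched_sgd f df L smooth L0 g H x0 xstar
  (fun t => xi t w) fmin K.
rewrite /A /=; under eq_bigr do rewrite sqr_l2norm.
rewrite -KT mulrC ler_pdivrMr// (le_trans sum_le)//.
(* (s / H) ^ 2 * 32 H * K = 32 s ^ 2 as K = H *)
rewrite (_ : \sum_(k < K) _ = 32 * sigma ^+ 2 * Z w); last first.
  rewrite /Z !mulr_sumr; apply: eq_bigr => k _.
  rewrite -/x_ -[x_ _ k]/(X k w) errE dotZl dotZr /Y -s2 -KH natrD.
  by field; rewrite (lt0r_neq0 KR) lt0r_neq0 ?addr_gt0.
have r0 : 0 <= f x0 - f xstar by rewrite subr_ge0.
rewrite [leRHS](_ : _ = 8 * L * (f x0 - f xstar) + 32 * sigma ^+ 2 * ln x).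
  rewrite lerD//; first by rewrite ler_wpM2r// ler_pM2r//; lra.
  apply: ler_wpM2l; last exact: ltW.
  by rewrite mulr_ge0// sqr_ge0.
by rewrite -/x; field; rewrite lt0r_neq0.
Qed.
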